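(* Let $A,A^*\in\mathrm{Mat}_{d+1}(\mathbb K)$ be as in the setup below. The following are equivalent: (i) $A,A^*$ is a Leonard pair; (ii) there exist an invertible $G\in\mathrm{Mat}_{d+1}(\mathbb K)$ and nonzero $\phi_1,\ldots,\phi_d\in\mathbb K$ such that $G^{-1}AG$ is the lower bidiagonal matrix with diagonal entries $\theta_d,\theta_{d-1},\ldots,\theta_0$ (i.e. $(i,i)$ entry $\theta_{d-i}$), all subdiagonal entries equal to $1$, and all other entries $0$; and $G^{-1}A^*G$ is the upper bidiagonal matrix with $(i,i)$ entry $\theta^*_i$, $(i-1,i)$ entry $\phi_i$ for $1\le i\le d$, and all other entries $0$. Moreover, if (i),(ii) hold, then $\phi_1,\ldots,\phi_d$ is the split sequence for $A,A^*$ with respect to the orderings $E_d,E_{d-1},\ldots,E_0$ and $E^*_0,E^*_1,\ldots,E^*_d$.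
   Context: Let $\mathbb K$ be a field and $d\ge0$ an integer; rows/columns are indexed $0,\ldots,d$. Let $\theta_0,\ldots,\theta_d\in\mathbb K$ be mutually distinct, $\theta^*_0,\ldots,\theta^*_d\in\mathbb K$ mutually distinct, and $\varphi_1,\ldots,\varphi_d\in\mathbb K$ nonzero. Let $A\in\mathrm{Mat}_{d+1}(\mathbb K)$ be lower bidiagonal with $A_{ii}=\theta_i$, $A_{i+1,i}=1$ and all other entries $0$; let $A^*$ be upper bidiagonal with $A^*_{ii}=\theta^*_i$, $A^*_{i-1,i}=\varphi_i$ and all other entries $0$. For $0\le i\le d$ let $E_i$ (resp. $E^*_i$) be the primitive idempotent of $A$ (resp. $A^*$) for $\theta_i$ (resp. $\theta^*_i$), i.e. $E_i=\prod_{j\ne i}(A-\theta_jI)/(\theta_i-\theta_j)$. A square matrix is tridiagonal if every nonzero entry lies on the diagonal, subdiagonal or superdiagonal, and irreducible tridiagonal if moreover all sub- and superdiagonal entries are nonzero. $A,A^*$ is a Leonard pair if there is a basis of $\mathbb K^{d+1}$ in which $A$ is represented by an irreducible tridiagonal matrix and $A^*$ by a diagonal one, and a basis in which $A^*$ is irreducible tridiagonal and $A$ diagonal. A decomposition of $V=\mathbb K^{d+1}$ is a sequence $V_0,\ldots,V_d$ of 1-dimensional subspaces with $V$ their direct sum. Given orderings $F_0,\ldots,F_d$ of the primitive idempotents of $A$ (with eigenvalues $\eta_i$) and $F^*_0,\ldots,F^*_d$ of those of $A^*$ (eigenvalues $\eta^*_i$), the decomposition is split w.r.t. these orderings if $(A-\eta_iI)V_i=V_{i+1}$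 ($0\le i\le d-1$), $(A-\eta_dI)V_d=0$, $(A^*-\eta^*_iI)V_i=V_{i-1}$ ($1\le i\le d$), $(A^*-\eta^*_0I)V_0=0$. Such a split decomposition is unique if it exists, and for $1\le i\le d$, $V_i$ is an eigenspace of $(A-\eta_{i-1}I)(A^*-\eta^*_iI)$ with nonzero eigenvalue $\psi_i$; the sequence $\psi_1,\ldots,\psi_d$ is called the split sequence for $A,A^*$ with respect to these orderings. *)

(* Defs.v *)
From HB Require Import structures.
From mathcomp Require Import all_boot all_order all_algebra.
Set Implicit Arguments. Unset Strict Implicit. Unset Printing Implicit Defensive.
Import GRing.Theory.
Local Open Scope ring_scope.

(* Sequences theta_0..theta_d etc. are given as functions nat -> K; only the
   values at indices 0..d (resp. 1..d for phi) matter. Matrices are indexed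
   0..d by 'I_d.+1. *)

Definition lbd_mx (K : fieldType) (d : nat) (th : nat -> K) : 'M[K]_d.+1 :=
  \matrix_(i, j) (if i == j :> nat then th i
                  else if i == j.+1 :> nat then 1 else 0).

Definition ubd_mx (K : fieldType) (d : nat) (ths phi : nat -> K) : 'M[K]_d.+1 :=
  \matrix_(i, j) (if i == j :> nat then ths i
                  else if j == i.+1 :> nat then phi j else 0).

Definition tridiagonal (K : fieldType) (n : nat) (M : 'M[K]_n) : Prop :=
  forall i j : 'I_n, (i.+1 < j)%N \/ (j.+1 < i)%N -> M i j = 0.

Definition irred_tridiagonal (K : fieldType) (n : nat) (M : 'M[K]_n) : Prop :=
  tridiagonal M /\
  forall i j : 'I_n, i.+1 = j :> nat -> M i j != 0 /\ M j i != 0.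

Definition diagonal (K : fieldType) (n : nat) (M : 'M[K]_n) : Prop :=
  forall i j : 'I_n, i != j -> M i j = 0.

(* A basis of K^{d+1} is given by the columns of an invertible matrix P;
   the matrix representing A in that basis is P^{-1} A P. *)
Definition leonard_pair (K : fieldType) (n : nat) (A As : 'M[K]_n) : Prop :=
  (exists P : 'M[K]_n, P \in unitmx /\
     irred_tridiagonal (invmx P *m A *m P) /\ diagonal (invmx P *m As *m P)) /\
  (exists Q : 'M[K]_n, Q \in unitmx /\
     irred_tridiagonal (invmx Q *m As *m Q) /\ diagonal (invmx Q *m A *m Q)).

(* Subspaces of K^{d+1} are represented (mxalgebra style) by the row space of
   a matrix X, whose rows are the (transposed) vectors of the subspace.
   The image of the subspace X under the linear map v |-> M v (column vectors)
   is then the row space of X *m M^T. *)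
Definition imgmx (K : fieldType) (n : nat) (M : 'M[K]_n) (X : 'M[K]_n) : 'M[K]_n :=
  X *m M^T.

(* V_0..V_d is a decomposition of K^{d+1} (1-dimensional summands, direct sum
   equal to the whole space) which is split w.r.t. orderings of the primitive
   idempotents of A, As having eigenvalues eta_0..eta_d, etas_0..etas_d. *)
Definition split_decomposition (K : fieldType) (d : nat) (A As : 'M[K]_d.+1)
  (eta etas : nat -> K) (V : nat -> 'M[K]_d.+1) : Prop :=
  [/\ forall i, (i <= d)%N -> \rank (V i) = 1%N,
      mxdirect (\sum_(i < d.+1) V i) &
      (\sum_(i < d.+1) V i :=: 1%:M)%MS] /\
  [/\
      (forall i, (i < d)%N -> (imgmx (A - (eta i)%:M) (V i) :=: V i.+1)%MS),
      imgmx (A - (eta d)%:M) (V d) = 0,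
      (forall i, (1 <= i <= d)%N ->
         (imgmx (As - (etas i)%:M) (V i) :=: V i.-1)%MS) &
      imgmx (As - (etas 0%N)%:M) (V 0%N) = 0].

Definition split_sequence (K : fieldType) (d : nat) (A As : 'M[K]_d.+1)
  (eta etas psi : nat -> K) : Prop :=
  exists V : nat -> 'M[K]_d.+1,
    split_decomposition A As eta etas V /\
    forall i, (1 <= i <= d)%N ->
      imgmx ((A - (eta i.-1)%:M) *m (As - (etas i)%:M)) (V i) = psi i *: V i.

(* Main.v *)
Require Import Defs.
From HB Require Import structures.
From mathcomp Require Import all_boot all_order all_algebra.
From mathcomp Require Import zify ring.
Import GRing.Theory.
Local Open Scope ring_scope.

(* Let R be the lower triangular eigenvector matrix of A; then C = R^-1 A^* R vanishes above the
   superdiagonal, where it is nonzero.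

   If A, A^* is a Leonard pair, the zero pattern of C is symmetric, so C is irreducible tridiagonal.
   The vectors v_i = (A - theta_(d-i+1)) ... (A - theta_d) e_0 are the columns of an upper
   unitriangular G putting A in the reversed bidiagonal form. Then M = G^-1 A^* G is upper triangular,
   and it is also a conjugate of the reversal of C by a lower triangular matrix, so nothing survives
   above its superdiagonal: M is bidiagonal.

   Conversely, the form (ii) says that the reversal of C also vanishes above the superdiagonal, so C
   is irreducible tridiagonal. In a basis where A^* is diagonal, A vanishes below the subdiagonal, where
   it is nonzero; that it is tridiagonal follows from the antiautomorphism fixing A and A^*. *)

Set Implicit Arguments.
Unset Strict Implicit.

(** * Invertible triangular matrices and Hessenberg patterns *)

Section Triangular.
Context {K : fieldType} {n : nat}.
Implicit Types (L M : 'M[K]_n) (i j : 'I_n).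

Definition trig_unit L := is_trig_mx L /\ forall i, L i i != 0.

(* Lower Hessenberg with nonzero superdiagonal. *)
Definition lhess M : Prop :=
  (forall i j, (i.+1 < j)%N -> M i j = 0) /\
  (forall i j, i.+1 = j :> nat -> M i j != 0).

Lemma trig_unit_unitmx L : trig_unit L -> L \in unitmx.
Proof.
case=> Ltrig Ldiag; rewrite unitmxE det_trig // unitfE.
by apply/prodf_neq0 => i _; apply: Ldiag.
Qed.

Lemma trig_mulmx_diag L M i :
  is_trig_mx L -> is_trig_mx M -> (L *m M) i i = L i i * M i i.
Proof.
move=> /is_trig_mxP L0 /is_trig_mxP M0; rewrite mxE (bigD1 i) //= big1 ?addr0 //.
move=> k; rewrite neq_ltn => /orP[lt_ki|lt_ik]; first by rewrite M0 ?mulr0.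
by rewrite L0 ?mul0r.
Qed.

Lemma trig_mulmx L M : is_trig_mx L -> is_trig_mx M -> is_trig_mx (L *m M).
Proof.
move=> /is_trig_mxP L0 /is_trig_mxP M0; apply/is_trig_mxP => i j lt_ij.
rewrite mxE big1 // => k _; case: (leqP k i) => [le_ki|lt_ik].
  by rewrite M0 ?mulr0 // (leq_ltn_trans le_ki).
by rewrite L0 ?mul0r.
Qed.

(** Forward substitution: by strong induction on the row, entry [(i, j)] of [L *m invmx L = 1%:M]
    with [i < j] reduces to [L i i * invmx L i j = 0]. *)
Lemma trig_invmx L : trig_unit L -> is_trig_mx (invmx L).
Proof.
move=> Ltu; have [/is_trig_mxP L0 Ldiag] := Ltu.
have LV : L *m invmx L = 1%:M by rewrite mulmxV // trig_unit_unitmx.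
apply/is_trig_mxP => i.
elim/ltn_ind: {i}(nat_of_ord i) {-2}i (erefl (nat_of_ord i)) => m IHm i im j lt_ij.
have /matrixP/(_ i j) := LV; rewrite !mxE (bigD1 i) //= big1 ?addr0 => [|k].
  move/eqP; rewrite (_ : (i == j) = false) ?mulf_eq0 ?(negPf (Ldiag i)) /=.
    by move/eqP.
  by apply/eqP => eij; rewrite eij ltnn in lt_ij.
rewrite neq_ltn => /orP[lt_ki|lt_ik]; last by rewrite L0 ?mul0r.
by rewrite (IHm k) ?mulr0 -?im // (ltn_trans lt_ki).
Qed.

Lemma trig_invmx_diag L i : trig_unit L -> (invmx L) i i = (L i i)^-1.
Proof.
move=> Ltu; have /matrixP/(_ i i) := mulmxV (trig_unit_unitmx Ltu).
rewrite trig_mulmx_diag ?trig_invmx //; last by case: Ltu.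
by rewrite mxE eqxx => /mulr1_eq.
Qed.

Lemma trig_unit_inv L : trig_unit L -> trig_unit (invmx L).
Proof.
move=> Ltu; split=> [|i]; first exact: trig_invmx.
by rewrite trig_invmx_diag // invr_eq0; case: Ltu => _; apply.
Qed.

(** Strictly above the diagonal a single term of the product survives, so multiplying by [L] only
    rescales row [i] by [L i i] there. *)
Lemma lhess_mulmxl L M : trig_unit L -> lhess M -> lhess (L *m M).
Proof.
case=> /is_trig_mxP L0 Ldiag [M0 M1].
have LM i j : (i < j)%N -> (L *m M) i j = L i i * M i j.
  move=> lt_ij; rewrite mxE (bigD1 i) //= big1 ?addr0 // => k.
  rewrite neq_ltn => /orP[lt_ki|lt_ik]; last by rewrite L0 ?mul0r.
  by rewrite M0 ?mulr0 // (leq_ltn_trans lt_ki).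
split=> i j ij; first by rewrite LM ?M0 ?mulr0 // ltnW.
by rewrite LM ?mulf_neq0 ?M1 // ij.
Qed.

Lemma lhess_mulmxr L M : trig_unit L -> lhess M -> lhess (M *m L).
Proof.
case=> /is_trig_mxP L0 Ldiag [M0 M1].
have ML i j : (i < j)%N -> (M *m L) i j = M i j * L j j.
  move=> lt_ij; rewrite mxE (bigD1 j) //= big1 ?addr0 // => k.
  rewrite neq_ltn => /orP[lt_kj|lt_jk]; first by rewrite L0 ?mulr0.
  by rewrite M0 ?mul0r // (leq_ltn_trans lt_ij).
split=> i j ij; first by rewrite ML ?M0 ?mul0r // ltnW.
by rewrite ML ?mulf_neq0 ?M1 // ij.
Qed.

(** Separates the two halves, which have different sources: one comes from a bidiagonal form, the
    other from a symmetry or from the reversed form. *)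
Lemma irred_tridiagonalP M : irred_tridiagonal M <-> lhess M /\ lhess M^T.
Proof.
split=> [[M0 M1]|[[M0 M1] [N0 N1]]].
  split; split=> i j ij; rewrite ?mxE; try by [apply: M0; left | apply: M0; right].
    by case: (M1 i j ij).
  by case: (M1 i j ij).
split=> i j; last by move=> ij; split; [exact: M1 | have := N1 _ _ ij; rewrite mxE].
by case=> ij; [apply: M0 | have := N0 _ _ ij; rewrite mxE].
Qed.

End Triangular.

(** * Matrices intertwining two diagonal matrices *)

Section DiagonalConjugation.
Context {K : fieldType} {n : nat}.
Implicit Types (W C N : 'M[K]_n) (a b : 'rV[K]_n).

Lemma intertwine_diag a b W :
  diag_mx a *m W = W *m diag_mx b ->
  forall k i, W k i != 0 -> a 0 k = b 0 i.
Proof.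
move=> aW k i nz; have /matrixP/(_ k i) := aW.
rewrite mul_diag_mx mul_mx_diag !mxE mulrC => /(mulfI nz); exact.
Qed.

(* [W] is a permutation matrix up to nonzero scalars, so conjugating by it only moves the zero pattern. *)
Lemma conj_pattern a b W C N :
  injective (b 0) -> W \in unitmx ->
  diag_mx a *m W = W *m diag_mx b -> C *m W = W *m N ->
  exists s : 'I_n -> 'I_n, (forall i, a 0 (s i) = b 0 i) /\
    forall i j, (N i j == 0) = (C (s i) (s j) == 0).
Proof.
move=> b_inj Wu /intertwine_diag aW CW.
have ex i : exists k, W k i != 0.
  case: (pickP (fun k => W k i != 0)) => [k Wki|W0]; first by exists k.
  have /matrixP/(_ i i) := mulVmx Wu; rewrite !mxE eqxx big1 => [/eqP|k _].
    by rewrite eq_sym oner_eq0.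
  by move/negbFE/eqP: (W0 k) => ->; rewrite mulr0.
(* [s i] is the row of a nonzero entry in column [i]. Since that entry forces [a 0 (s i) = b 0 i],
   distinctness of the [b 0 i] makes [s] a bijection and the entry unique in its column. *)
pose s i := xchoose (ex i); have sP i : W (s i) i != 0 by apply: (xchooseP (ex i)).
have s_inj : injective s.
  move=> i j sij; apply: b_inj.
  by rewrite -(aW _ _ (sP i)) -(aW _ _ (sP j)) sij.
have [t sK tK] := injF_bij s_inj.
have W0 k i : k != s i -> W k i = 0.
  apply: contraNeq => nz; rewrite -[k]tK; apply/eqP; congr (s _); apply: b_inj.
  by rewrite -(aW _ _ nz) -(aW _ _ (sP (t k))) tK.
exists s; split=> [i|i j]; first exact: aW.
have /matrixP/(_ (s i) j) := CW.
rewrite !mxE (bigD1 (s j)) //= big1 ?addr0 => [|k ks]; last by rewrite W0 ?mulr0.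
rewrite (bigD1 i) //= big1 ?addr0 => [e|k ki].
  by have := congr1 (fun x => x == 0) e; rewrite !mulf_eq0 (negPf (sP i)) (negPf (sP j)) orbF.
by rewrite W0 ?mul0r // (inj_eq s_inj) eq_sym.
Qed.

Lemma diagonal_diag_mx (M : 'M[K]_n) : diagonal M -> M = diag_mx (\row_i M i i).
Proof.
move=> M0; apply/matrixP => i j; rewrite !mxE.
by case: eqVneq => [->|/M0->]; rewrite ?mulr1n ?mulr0n.
Qed.

End DiagonalConjugation.

Lemma invmx_intertwine (K : fieldType) (n : nat) (A B P : 'M[K]_n) :
  P \in unitmx -> A *m P = P *m B -> invmx P *m A = B *m invmx P.
Proof. by move=> Pu AP; apply: (canRL (mulmxK Pu)); rewrite -mulmxA AP mulKmx. Qed.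

(** * Symmetrizing an irreducible tridiagonal matrix *)

Lemma tridiagonal_symmetrizer (K : fieldType) (n : nat) (C : 'M[K]_n) :
  irred_tridiagonal C ->
  exists x : 'rV[K]_n, (forall i, x 0 i != 0) /\ diag_mx x *m C = C^T *m diag_mx x.
Proof.
case: n C => [|n] C [C0 C1].
  by exists 0; split=> [[]//|]; apply/matrixP => [[]].
(* Solves [x_(k+1) C_(k+1,k) = x_k C_(k,k+1)] from [x_0 = 1]; for [m <= n] all indices are in
   range. *)
pose x m : K := \prod_(k < m) (C (inord k) (inord k.+1) / C (inord k.+1) (inord k)).
have x0 (m : 'I_n.+1) : x m != 0.
  apply/prodf_neq0 => k _.
  have lt_kn : (k.+1 < n.+1)%N by apply: leq_ltn_trans (ltn_ord m).
  have [|? ?] := C1 (inord k) (inord k.+1); first by rewrite !inordK // ltnW.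
  by rewrite mulf_neq0 ?invr_eq0.
have xS (i j : 'I_n.+1) : i.+1 = j :> nat -> x j * C j i = x i * C i j.
  move=> ij; have [_ nz] := C1 i j ij.
  rewrite -ij /x big_ord_recr /= ij !inord_val -mulrA divfK //.
exists (\row_i x i); split=> [i|]; first by rewrite mxE.
apply/matrixP => i j; rewrite mul_diag_mx mul_mx_diag !mxE mulrC.
have [ij|ji|/val_inj->//] := ltngtP i j.
  move: ij; rewrite leq_eqVlt => /predU1P[/xS e|lt]; first by rewrite mulrC -e mulrC.
  by rewrite (C0 i j) ?(C0 j i) ?mul0r; auto.
move: ji; rewrite leq_eqVlt => /predU1P[/xS e|lt]; first by rewrite mulrC e mulrC.
by rewrite (C0 i j) ?(C0 j i) ?mul0r; auto.
Qed.

(* A diagonal matrix symmetrizing [C] gives an antiautomorphism fixing [diag_mx a] and [C]; it fixes the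
   eigenprojections of [C], so it transposes the zero pattern of [diag_mx a] in an eigenbasis of [C]. *)
Lemma eigenbasis_pattern_sym (K : fieldType) (n : nat) (a b : 'rV[K]_n) (C B Z : 'M[K]_n) :
  irred_tridiagonal C -> Z \in unitmx -> injective (b 0) ->
  C *m Z = Z *m diag_mx b -> diag_mx a *m Z = Z *m B ->
  forall i j, (B i j == 0) = (B j i == 0).
Proof.
move=> /tridiagonal_symmetrizer[x [x0 xC]] Zu b_inj CZ aZ i j.
(* Gram matrix, in the eigenbasis [Z], of the bilinear form [diag_mx x], for which [C] and
   [diag_mx a] are self-adjoint. It commutes with [diag_mx b], hence is diagonal, and it intertwines
   [B] with [B^T]. *)
pose Y := Z^T *m diag_mx x *m Z.
have Yu : Y \in unitmx.
  rewrite !unitmx_mul unitmx_tr Zu andbT /= unitmxE det_diag unitfE.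
  by apply/prodf_neq0 => k _.
have ZC : diag_mx b *m Z^T = Z^T *m C^T.
  by rewrite -trmx_mul CZ trmx_mul tr_diag_mx.
have Za : B^T *m Z^T = Z^T *m diag_mx a.
  by rewrite -trmx_mul -aZ trmx_mul tr_diag_mx.
have bY : diag_mx b *m Y = Y *m diag_mx b.
  by rewrite /Y !mulmxA ZC -(mulmxA Z^T) -xC -!mulmxA CZ.
have BY : B^T *m Y = Y *m B.
  by rewrite /Y !mulmxA Za -(mulmxA Z^T) diag_mxC -!mulmxA aZ.
have [s [sb ->]] := conj_pattern b_inj Yu bY BY.
have sE k : s k = k by apply: b_inj.
by rewrite !sE mxE.
Qed.

(** * Eigenvectors of bidiagonal matrices *)

Section Bidiagonal.
Context {K : fieldType} {d : nat}.
Implicit Types (th ths c : nat -> K).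

Definition eigrow th : 'rV[K]_d.+1 := \row_i th i.

Lemma eigrow_inj th :
  (forall i j, (i <= d)%N -> (j <= d)%N -> i != j -> th i != th j) ->
  injective (eigrow th 0).
Proof.
move=> th_inj i j; rewrite !mxE => eq_th; apply/val_inj/eqP.
apply: contra_eqT eq_th => ne_ij; exact: th_inj (leq_ord i) (leq_ord j) ne_ij.
Qed.

Lemma lbd_mxE th : lbd_mx d th = (ubd_mx d th (fun=> 1))^T.
Proof. by apply/matrixP => i j; rewrite !mxE eq_sym; case: eqVneq => // ->. Qed.

Lemma lhess_ubd ths c :
  (forall i, (1 <= i <= d)%N -> c i != 0) -> lhess (ubd_mx d ths c).
Proof.
move=> c0; split=> i j ij; rewrite mxE.
  by rewrite ltn_eqF ?(ltn_trans _ ij) // gtn_eqF.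
rewrite -ij eqxx ltn_eqF //; apply: c0.
by rewrite /= ij leq_ord.
Qed.

(** The row recurrence behind both the eigenvectors and the Krylov vectors; the test [i == 0] guards
    the truncated [i.-1]. *)
Lemma mul_ubdT_mx m th c (M : 'M[K]_(d.+1, m)) i j :
  ((ubd_mx d th c)^T *m M) i j =
  th i * M i j + (if (i == 0 :> nat)%N then 0 else c i * M (inord i.-1) j).
Proof.
rewrite mxE (bigD1 i) //= !mxE eqxx; congr (_ + _).
have [i0|i_gt0] := posnP i.
  rewrite big1 // => k ki; rewrite !mxE.
  by move: ki; rewrite -val_eqE /= => /negPf->; rewrite i0 mul0r.
have le_i : (i.-1 < d.+1)%N by rewrite (leq_ltn_trans (leq_pred _)).
rewrite (bigD1 (inord i.-1)) /= ?big1 ?addr0.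
- by rewrite !mxE inordK // prednK // eqxx ltn_eqF // prednK.
- move=> k /andP[ki kp]; rewrite !mxE.
  move: ki; rewrite -val_eqE /= => /negPf->.
  case: eqP => [ik|_]; last by rewrite mul0r.
  by case/eqP: kp; apply: val_inj; rewrite /= inordK // ik.
- by rewrite -val_eqE /= inordK // ltn_eqF // prednK.
Qed.

Lemma ubdT_eigenmatrix th c :
  (forall i j, (i <= d)%N -> (j <= d)%N -> i != j -> th i != th j) ->
  exists R : 'M[K]_d.+1,
    trig_unit R /\ (ubd_mx d th c)^T *m R = R *m diag_mx (eigrow th).
Proof.
move=> th_inj.
(* Solves the eigenvector recurrence [(th j - th i) * r i j = c i * r i.-1 j] for [j < i], with
   [r j j = 1]. *)
pose r (i j : nat) := \prod_(j.+1 <= k < i.+1) (c k / (th j - th k)).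
exists (\matrix_(i, j) if (j <= i)%N then r i j else 0); split.
  split=> [|i]; first by apply/is_trig_mxP => i j ij; rewrite mxE leqNgt ij.
  by rewrite mxE leqnn /r big_geq ?oner_neq0.
apply/matrixP => i j; rewrite mul_ubdT_mx mul_mx_diag !mxE.
have le_i : (i.-1 < d.+1)%N by rewrite (leq_ltn_trans (leq_pred _)).
rewrite inordK //; case: (ltngtP j i) => [ji|ij|/val_inj->].
- have i_gt0 : (0 < i)%N by apply: leq_ltn_trans ji.
  rewrite gtn_eqF // -ltnS prednK // ji /r big_nat_recr //= prednK //.
  have nz : th j - th i != 0 by rewrite subr_eq0 th_inj ?leq_ord // neq_ltn ji.
  set p := \prod_(_ <= _ < _) _.
  rewrite -[X in _ + X * _](divfK nz).
  by ring.
- rewrite mulr0 mul0r add0r; case: eqP => // /eqP; rewrite -lt0n => i_gt0.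
  by rewrite leqNgt -ltnS prednK // (ltn_trans ij) ?mulr0.
- have [->|i_gt0] := posnP i; first by rewrite addr0 mulrC.
  by rewrite leqNgt prednK // leqnn mulr0 addr0 mulrC.
Qed.

End Bidiagonal.

(** * Reversing the order of the eigenvalues of [A] *)

Section ReversedForm.
Context {K : fieldType} (d : nat).
Variable th : nat -> K.
Hypothesis th_inj : forall i j, (i <= d)%N -> (j <= d)%N -> i != j -> th i != th j.
Let thr i := th (d - i)%N.

Lemma thr_inj : forall i j, (i <= d)%N -> (j <= d)%N -> i != j -> thr i != thr j.
Proof.
move=> i j le_i le_j ne_ij; rewrite th_inj ?leq_subr //.
by apply: contra ne_ij => /eqP e; rewrite -(subKn le_i) e subKn.
Qed.

(** [R] and [G *m R'] both diagonalize [A], with the eigenvalues in opposite orders, so the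
    transition matrix between them is the reversal permutation up to nonzero scalars. *)
Lemma reversed_pattern (A B G R R' : 'M[K]_d.+1) :
  G \in unitmx -> R \in unitmx -> R' \in unitmx ->
  A *m R = R *m diag_mx (eigrow th) ->
  invmx G *m A *m G *m R' = R' *m diag_mx (eigrow thr) ->
  forall i j, ((invmx R' *m (invmx G *m B *m G) *m R') i j == 0) =
              ((invmx R *m B *m R) (rev_ord i) (rev_ord j) == 0).
Proof.
move=> Gu Ru R'u AR AR' i j.
have AGR : A *m G *m R' = G *m (R' *m diag_mx (eigrow thr)).
  by rewrite -AR' !mulmxA mulmxV // mul1mx.
pose W := invmx R *m G *m R'.
have Wu : W \in unitmx by rewrite !unitmx_mul unitmx_inv Ru Gu.
have aW : diag_mx (eigrow th) *m W = W *m diag_mx (eigrow thr).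
  rewrite /W !mulmxA -(invmx_intertwine Ru AR) -!mulmxA; congr (_ *m _).
  by rewrite mulmxA AGR.
have CW : (invmx R *m B *m R) *m W = W *m (invmx R' *m (invmx G *m B *m G) *m R').
  rewrite /W -!mulmxA; congr (_ *m _).
  by rewrite !(mulKVmx Ru) (mulKVmx R'u) (mulKVmx Gu).
have [s [sE ->]] := conj_pattern (eigrow_inj thr_inj) Wu aW CW.
suff s_rev k : s k = rev_ord k by rewrite !s_rev.
by apply: (eigrow_inj th_inj); rewrite sE !mxE /= subSS.
Qed.

(** Reversing both indices exchanges the superdiagonal with the subdiagonal. *)
Lemma lhess_rev (C N : 'M[K]_d.+1) :
  (forall i j, (N i j == 0) = (C (rev_ord i) (rev_ord j) == 0)) ->
  lhess N <-> lhess C^T.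
Proof.
move=> NC.
have CN i j : (C^T i j == 0) = (N (rev_ord j) (rev_ord i) == 0).
  by rewrite NC !rev_ordK mxE.
have rev_lt (i j : 'I_d.+1) : (i.+1 < j)%N -> ((rev_ord j).+1 < rev_ord i)%N.
  by move=> ij; rewrite /= !subSS; have := leq_ord j; lia.
have rev_eq (i j : 'I_d.+1) : i.+1 = j :> nat -> (rev_ord j).+1 = rev_ord i :> nat.
  by move=> ij; rewrite /= !subSS; have := leq_ord j; lia.
have NC' i j : (N i j == 0) = (C^T (rev_ord j) (rev_ord i) == 0) by rewrite NC mxE.
split=> -[H0 H1]; split=> i j ij.
- by apply/eqP; rewrite CN H0 ?rev_lt.
- by rewrite CN; apply/H1/rev_eq.
- by apply/eqP; rewrite NC' H0 ?rev_lt.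
- by rewrite NC'; apply/H1/rev_eq.
Qed.

Lemma krylov_basis :
  exists G : 'M[K]_d.+1, trig_unit G^T /\ lbd_mx d th *m G = G *m lbd_mx d thr.
Proof.
pose A := lbd_mx d th.
pose q i : {poly K} := \prod_(j < i) ('X - (thr j)%:P).
(* The columns of [G]: the recurrence [vS] is the reversed bidiagonal relation, and it closes at
   [d.+1] by Cayley-Hamilton because [q d.+1] is the characteristic polynomial of [A]. *)
pose v i : 'cV[K]_d.+1 := horner_mx A (q i) *m delta_mx 0 0.
have vS i : v i.+1 = A *m v i - thr i *: v i.
  rewrite /v /q big_ord_recr /= mulrC rmorphM rmorphB /= horner_mx_X horner_mx_C.
  by rewrite -mulmxA mulmxBl mul_scalar_mx.
have v0 : v 0%N = delta_mx 0 0 by rewrite /v /q big_ord0 rmorph1 mul1mx.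
have v_end : v d.+1 = 0.
  have Atrig : is_trig_mx A.
    apply/is_trig_mxP => i j ij; rewrite mxE ltn_eqF // ltn_eqF //.
    exact: ltn_trans ij _.
  rewrite /v (_ : q d.+1 = char_poly A) ?Cayley_Hamilton ?mul0mx //.
  rewrite char_poly_trig // /q (reindex_inj rev_ord_inj); apply: eq_bigr => i _ /=.
  by rewrite mxE eqxx /thr subSS subKn // leq_ord.
clearbody v.
have AvE i (k : 'I_d.+1) : (A *m v i) k 0 =
    th k * v i k 0 + (if (k == 0 :> nat)%N then 0 else v i (inord k.-1) 0).
  by rewrite /A lbd_mxE mul_ubdT_mx mul1r.
(* The unit subdiagonal of [A] pushes the last nonzero coordinate one place further with coefficient
   1, so [G] is upper unitriangular. *)
have v_supp i (k : 'I_d.+1) : (i <= k)%N -> v i k 0 = (i == k)%:R.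
  elim: i k => [|i IHi] k ik.
    by rewrite v0 mxE andbT eq_sym.
  rewrite vS mxE AvE !mxE (IHi k) ?(ltnW ik) // (ltn_eqF ik) !mulr0 add0r subr0.
  have k_gt0 : (0 < k)%N by apply: leq_trans ik.
  have le_k : (k.-1 < d.+1)%N by rewrite (leq_ltn_trans (leq_pred _)).
  rewrite gtn_eqF // IHi inordK //; last by rewrite -ltnS prednK.
  by rewrite -(eqSS i) prednK.
exists (\matrix_(k, i) v i k 0); split.
  split=> [|i]; last by rewrite !mxE v_supp ?eqxx ?oner_neq0.
  by apply/is_trig_mxP => i j ij; rewrite !mxE v_supp ?(ltnW ij) // (ltn_eqF ij).
apply/matrixP => k i; pose f m := v m k 0 * (if m == i then thr m else if m == i.+1 then 1 else 0).
(* The extra index [d.+1] contributes zero and lets column [d] be treated like the others. *)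
have -> : (\matrix_(k, i) v i k 0 *m lbd_mx d thr) k i = \sum_(m < d.+2) f m.
  have vk0 : v d.+1 k 0 = 0 by rewrite v_end mxE.
  rewrite mxE [in RHS]big_ord_recr /f /= vk0 mul0r addr0.
  by apply: eq_bigr => m _; rewrite !mxE.
rewrite (bigD1 (widen_ord (leqnSn _) i)) // (bigD1 (lift ord0 i)) /=; last first.
  by rewrite -val_eqE /= gtn_eqF.
rewrite big1 ?addr0 => [|m /andP[mi mSi]]; last first.
  by move: mi mSi; rewrite -!val_eqE /f /= => /negPf-> /negPf->; rewrite mulr0.
rewrite /f /= /bump eqxx (gtn_eqF (ltnSn _)) eqxx mulr1 vS !mxE.
rewrite [v i k 0 * _]mulrC addrC subrK.
by apply: eq_bigr => m _; rewrite !mxE.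
Qed.

End ReversedForm.

(** * From the Leonard property to an irreducible tridiagonal matrix and back *)

Lemma lhess_conj (K : fieldType) (n : nat) (R M : 'M[K]_n) :
  trig_unit R -> lhess M -> lhess (invmx R *m M *m R).
Proof.
by move=> Rtu Mh; apply/lhess_mulmxr => //; apply/lhess_mulmxl/Mh/trig_unit_inv.
Qed.

Lemma irred_tridiagonal_sym (K : fieldType) (n : nat) (M : 'M[K]_n) :
  irred_tridiagonal M -> forall i j, (M i j == 0) = (M j i == 0).
Proof.
case=> M0 M1 i j; have [ij|ji|/val_inj->//] := ltngtP i j.
  move: ij; rewrite leq_eqVlt => /predU1P[/M1[/negPf-> /negPf->]//|lt].
  by rewrite (M0 i j) ?(M0 j i) ?eqxx; auto.
move: ji; rewrite leq_eqVlt => /predU1P[/M1[/negPf-> /negPf->]//|lt].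
by rewrite (M0 i j) ?(M0 j i) ?eqxx; auto.
Qed.

Lemma lhess_sym_irred (K : fieldType) (n : nat) (M : 'M[K]_n) :
  (forall i j, (M i j == 0) = (M j i == 0)) -> lhess M -> irred_tridiagonal M.
Proof.
move=> Msym Mh; apply/irred_tridiagonalP; split=> //; case: Mh => M0 M1.
split=> i j ij; rewrite mxE; last by rewrite -Msym M1.
by apply/eqP; rewrite -Msym M0.
Qed.

Lemma irred_tridiagonal_tr (K : fieldType) (n : nat) (M : 'M[K]_n) :
  irred_tridiagonal M^T -> irred_tridiagonal M.
Proof.
by move=> /irred_tridiagonalP[Mh MTh]; apply/irred_tridiagonalP; rewrite -{1}[M]trmxK.
Qed.

Lemma diagonal_diag (K : fieldType) (n : nat) (a : 'rV[K]_n) : diagonal (diag_mx a).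
Proof. by move=> i j ij; rewrite mxE (negPf ij). Qed.

Lemma lbd_eigenmatrix (K : fieldType) (d : nat) (th : nat -> K) :
  (forall i j, (i <= d)%N -> (j <= d)%N -> i != j -> th i != th j) ->
  exists R : 'M[K]_d.+1,
    trig_unit R /\ lbd_mx d th *m R = R *m diag_mx (eigrow th).
Proof. by move=> th_inj; rewrite lbd_mxE; apply: ubdT_eigenmatrix. Qed.

Lemma leonard_pair_of_irred (K : fieldType) (d : nat) (th ths phi : nat -> K)
  (R : 'M[K]_d.+1)
  (Hths : forall i j, (i <= d)%N -> (j <= d)%N -> i != j -> ths i != ths j) :
  trig_unit R -> lbd_mx d th *m R = R *m diag_mx (eigrow th) ->
  irred_tridiagonal (invmx R *m ubd_mx d ths phi *m R) ->
  leonard_pair (lbd_mx d th) (ubd_mx d ths phi).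
Proof.
set A := lbd_mx d th; set As := ubd_mx d ths phi => Rtu AR irrC.
have Ru := trig_unit_unitmx Rtu.
have [R2 [R2tu AsR2]] := ubdT_eigenmatrix phi Hths.
have R2u := trig_unit_unitmx R2tu.
(* The inverse transpose of an eigenvector matrix of [As^T] is an eigenvector matrix of [As]. *)
pose T := (invmx R2)^T.
have Tu : T \in unitmx by rewrite unitmx_tr unitmx_inv.
have AsT : As *m T = T *m diag_mx (eigrow ths).
  apply: trmx_inj; rewrite !trmx_mul !trmxK tr_diag_mx.
  exact: invmx_intertwine R2u AsR2.
split; last first.
  exists R; split=> //; split=> //.
  by rewrite -mulmxA AR mulKmx //; apply: diagonal_diag.
exists T; split=> //; split; last first.
  by rewrite -mulmxA AsT mulKmx //; apply: diagonal_diag.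
(* Passes from the eigenbasis of [A] to that of [As]; it diagonalizes the irreducible tridiagonal
   conjugate of [As]. *)
pose Z := invmx R *m T.
have Zu : Z \in unitmx by rewrite unitmx_mul unitmx_inv Ru.
have CZ : (invmx R *m As *m R) *m Z = Z *m diag_mx (eigrow ths).
  by rewrite /Z -!mulmxA mulKVmx // AsT.
have aZ : diag_mx (eigrow th) *m Z = Z *m (invmx T *m A *m T).
  by rewrite /Z !mulmxA -(invmx_intertwine Ru AR) -!mulmxA mulKVmx.
have sym := eigenbasis_pattern_sym irrC Zu (eigrow_inj Hths) CZ aZ.
apply: irred_tridiagonal_tr; apply: lhess_sym_irred => [i j|].
  by rewrite mxE [in RHS]mxE sym.
(* The transpose of [invmx T *m A *m T] is the conjugate of the upper bidiagonal [A^T] by the lower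
   triangular [R2]. *)
rewrite !trmx_mul (trmx_inv T) /T !trmxK invmxK mulmxA /A lbd_mxE trmxK.
apply: lhess_conj => //; apply: lhess_ubd => i _; exact: oner_neq0.
Qed.

(** Eigenbases of [A] agree up to order and scaling, so the symmetric zero pattern seen in the
    Leonard basis [Q] carries over to [R]. *)
Lemma leonard_pair_irred (K : fieldType) (n : nat) (a : 'rV[K]_n) (A As R : 'M[K]_n) :
  leonard_pair A As -> R \in unitmx -> injective (a 0) ->
  A *m R = R *m diag_mx a ->
  lhess (invmx R *m As *m R) -> irred_tridiagonal (invmx R *m As *m R).
Proof.
move=> [_ [Q [Qu [irrQ /diagonal_diag_mx diagQ]]]] Ru a_inj AR.
apply: lhess_sym_irred => i j.
pose W := invmx Q *m R.
have Wu : W \in unitmx by rewrite unitmx_mul unitmx_inv Qu.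
have aW : invmx Q *m A *m Q *m W = W *m diag_mx a.
  by rewrite /W -!mulmxA mulKVmx // AR.
have CW : (invmx Q *m As *m Q) *m W = W *m (invmx R *m As *m R).
  by rewrite /W -!mulmxA !mulKVmx.
rewrite diagQ in aW.
have [s [_ sE]] := conj_pattern a_inj Wu aW CW.
by rewrite !sE irred_tridiagonal_sym.
Qed.

(** * Split decompositions from bidiagonal forms *)

Lemma delta_mulmx (K : fieldType) (n m p : nat) (i : 'I_n) (j : 'I_m) (X : 'M[K]_(m, p)) k l :
  (delta_mx i j *m X) k l = (k == i)%:R * X j l.
Proof.
rewrite mxE (bigD1 j) //= big1 ?addr0 => [|h hj]; first by rewrite mxE eqxx andbT.
by rewrite mxE (negPf hj) andbF mul0r.
Qed.

Lemma split_sequence_bidiagonal (K : fieldType) (d : nat) (A As G : 'M[K]_d.+1)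
    (eta etas psi : nat -> K) :
  G \in unitmx -> (forall i, (1 <= i <= d)%N -> psi i != 0) ->
  A *m G = G *m lbd_mx d eta -> As *m G = G *m ubd_mx d etas psi ->
  split_sequence A As eta etas psi.
Proof.
move=> Gu psi0 AG AsG.
have GTu : G^T \in unitmx by rewrite unitmx_tr.
(* The line spanned by column [i] of [G], stored as row 0 of an otherwise zero square matrix. Fixing
   this generator turns the shifts below into matrix equalities, which keep track of the scalar
   [psi i]. *)
pose V i : 'M[K]_d.+1 := delta_mx 0 (inord i) *m G^T.
have imgE (X Y : 'M[K]_d.+1) i : X *m G = G *m Y ->
    imgmx X (V i) = delta_mx 0 (inord i) *m Y^T *m G^T.
  by move=> XG; rewrite /imgmx /V -!mulmxA -!trmx_mul XG.
have subc (X Y : 'M[K]_d.+1) c : X *m G = G *m Y ->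
    (X - c%:M) *m G = G *m (Y - c%:M).
  by move=> XG; rewrite mulmxBl mulmxBr XG mul_scalar_mx mul_mx_scalar.
have AS i : (i < d)%N -> imgmx (A - (eta i)%:M) (V i) = V i.+1.
  move=> lt_id; rewrite (imgE _ _ _ (subc _ _ _ AG)); congr (_ *m _).
  apply/matrixP => k l; rewrite delta_mulmx !mxE -mulnb natrM; congr (_ * _).
  rewrite -!val_eqE /= !inordK //; last exact: ltnW.
  case: eqVneq => [->|_]; first by rewrite mulr1n subrr ltn_eqF.
  by rewrite mulr0n subr0; case: eqP.
have Ad : imgmx (A - (eta d)%:M) (V d) = 0.
  rewrite (imgE _ _ _ (subc _ _ _ AG)) -[RHS](mul0mx _ G^T); congr (_ *m _).
  apply/matrixP => k l; rewrite delta_mulmx !mxE -!val_eqE /= !inordK //.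
  have [->|_] := eqVneq (l : nat) d; first by rewrite mulr1n subrr mulr0.
  by rewrite (ltn_eqF (ltn_ord l)) mulr0n subr0 mulr0.
have AsS i : (1 <= i <= d)%N -> imgmx (As - (etas i)%:M) (V i) = psi i *: V i.-1.
  case: i => // i /= lt_id.
  rewrite (imgE _ _ _ (subc _ _ _ AsG)) /V scalemxAl; congr (_ *m _).
  apply/matrixP => k l; rewrite delta_mulmx !mxE -mulnb natrM mulrCA; congr (_ * _).
  rewrite -!val_eqE /= !inordK //; last exact: ltnW.
  rewrite eqSS [i == l]eq_sym.
  case: eqVneq => [->|_]; first by rewrite mulr1n subrr gtn_eqF ?mulr0.
  by rewrite mulr0n subr0; case: eqP; rewrite ?mulr1 ?mulr0.
have As0 : imgmx (As - (etas 0%N)%:M) (V 0%N) = 0.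
  rewrite (imgE _ _ _ (subc _ _ _ AsG)) -[RHS](mul0mx _ G^T); congr (_ *m _).
  apply/matrixP => k l; rewrite delta_mulmx !mxE -!val_eqE /= !inordK //.
  have [->|_] := eqVneq (l : nat) 0%N; first by rewrite mulr1n subrr mulr0.
  by rewrite mulr0n subr0 mulr0.
have rkV i : \rank (V i) = 1%N.
  by rewrite mxrankMfree ?row_free_unit // mxrank_delta.
have sumV : (\sum_(i < d.+1) V i :=: 1%:M)%MS.
  apply/eqmxP; rewrite submx1 sub1mx /=.
  have : (G^T <= \sum_(i < d.+1) V i)%MS.
    apply/row_subP => i; apply: (sumsmx_sup i) => //.
    have -> : row i G^T = row 0 (V i); last exact: row_sub.
    rewrite /V inord_val.
    by apply/rowP => l; rewrite [RHS]mxE delta_mulmx eqxx mul1r mxE.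
  by rewrite -sub1mx; apply: submx_trans; rewrite sub1mx row_full_unit.
exists V; split; last first.
  move=> i /andP[i_gt0 le_id].
  have -> : imgmx ((A - (eta i.-1)%:M) *m (As - (etas i)%:M)) (V i) =
      imgmx (A - (eta i.-1)%:M) (imgmx (As - (etas i)%:M) (V i)).
    by rewrite /imgmx trmx_mul mulmxA.
  rewrite AsS ?i_gt0 // {1}/imgmx -scalemxAl.
  by rewrite -/(imgmx _ _) AS ?prednK.
do 2!split=> //.
- apply/mxdirectP => /=; rewrite sumV mxrank1.
  by under eq_bigr do rewrite rkV; rewrite sum1_card card_ord.
- by move=> i /AS->; apply: eqmx_refl.
- by move=> i le_i; rewrite AsS //; apply/eqmx_scale/psi0.
Qed.

(** * The equivalence and the split sequence *)

Lemma conj_intertwine (K : fieldType) (n : nat) (A B P : 'M[K]_n) :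
  P \in unitmx -> invmx P *m A *m P = B -> A *m P = P *m B.
Proof. by move=> Pu <-; rewrite -!mulmxA mulKVmx. Qed.

Unset Implicit Arguments.
Set Strict Implicit.

Theorem theorem6p3 (K : fieldType) (d : nat) (th ths phi : nat -> K)
  (Hth : forall i j, (i <= d)%N -> (j <= d)%N -> i != j -> th i != th j)
  (Hths : forall i j, (i <= d)%N -> (j <= d)%N -> i != j -> ths i != ths j)
  (Hphi : forall i, (1 <= i <= d)%N -> phi i != 0) :
  let A := lbd_mx d th in
  let As := ubd_mx d ths phi in
  (leonard_pair A As <->
     exists (G : 'M[K]_d.+1) (phi' : nat -> K),
       [/\ G \in unitmx,
           (forall i, (1 <= i <= d)%N -> phi' i != 0),
           invmx G *m A *m G = lbd_mx d (fun i => th (d - i)%N) &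
           invmx G *m As *m G = ubd_mx d ths phi'])
  /\
  (forall (G : 'M[K]_d.+1) (phi' : nat -> K),
     leonard_pair A As ->
     G \in unitmx ->
     (forall i, (1 <= i <= d)%N -> phi' i != 0) ->
     invmx G *m A *m G = lbd_mx d (fun i => th (d - i)%N) ->
     invmx G *m As *m G = ubd_mx d ths phi' ->
     split_sequence A As (fun i => th (d - i)%N) ths phi').
Proof.
move=> A As; split; last first.
  move=> G phi' _ Gu phi'0 AG AsG.
  apply: (split_sequence_bidiagonal Gu phi'0).
    exact: conj_intertwine Gu AG.
  exact: conj_intertwine Gu AsG.
have [R [Rtu AR]] := lbd_eigenmatrix Hth.
have [R' [R'tu AR']] := lbd_eigenmatrix (thr_inj Hth).
have Ru := trig_unit_unitmx Rtu; have R'u := trig_unit_unitmx R'tu.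
have Ch : lhess (invmx R *m As *m R) by apply/lhess_conj/lhess_ubd.
split=> [LP|[G [phi' [Gu phi'0 AG AsG]]]]; last first.
  apply: (leonard_pair_of_irred Hths Rtu AR).
  apply/irred_tridiagonalP; split=> //.
  rewrite -AG in AR'.
  apply/(lhess_rev (reversed_pattern Hth As Gu Ru R'u AR AR')).
  by rewrite AsG; apply/lhess_conj/lhess_ubd.
have [_ CTh] := (irred_tridiagonalP _).1
  (leonard_pair_irred LP Ru (eigrow_inj Hth) AR Ch).
have [G [GTtu AG]] := krylov_basis d th.
have Gu : G \in unitmx by rewrite -unitmx_tr trig_unit_unitmx.
have AG' : invmx G *m A *m G = lbd_mx d (fun i => th (d - i)%N).
  by rewrite -mulmxA AG mulKmx.
pose M := invmx G *m As *m G.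
have Mh : lhess M.
  rewrite -AG' in AR'.
  (* The lower half of the tridiagonal matrix controls the upper half of its reversal, whose zero
     pattern is that of [M] conjugated by [R']; undoing this triangular conjugation gives
     [lhess M]. *)
  have Nh := (lhess_rev (reversed_pattern Hth As Gu Ru R'u AR AR')).2 CTh.
  have := lhess_conj (trig_unit_inv R'tu) Nh.
  by rewrite invmxK -/M !mulmxA mulmxV // mul1mx -mulmxA mulmxV // mulmx1.
have AsT : is_trig_mx As^T.
  apply/is_trig_mxP => i j ij; rewrite !mxE gtn_eqF // ltn_eqF //.
  exact: ltn_trans ij _.
(* A product of lower triangular matrices: [M] is upper triangular, and the diagonal of [G] cancels,
   leaving that of [As]. *)
have MT : M^T = G^T *m (As^T *m invmx G^T).
  by rewrite /M !trmx_mul trmx_inv.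
have AsG : is_trig_mx (As^T *m invmx G^T) by rewrite trig_mulmx ?trig_invmx.
have M0 (i j : 'I_d.+1) : (j < i)%N -> M i j = 0.
  have /is_trig_mxP M0 : is_trig_mx M^T by rewrite MT trig_mulmx //; case: GTtu.
  by move=> ji; have := M0 j i ji; rewrite mxE.
have Mdiag i : M i i = ths i.
  have -> : M i i = M^T i i by rewrite [RHS]mxE.
  have [GTt GT0] := GTtu.
  rewrite MT !trig_mulmx_diag ?trig_invmx // trig_invmx_diag // !mxE eqxx.
  have := GT0 i; rewrite mxE => Gii.
  by rewrite mulrCA mulfV ?mulr1.
(* The scalars are read off the superdiagonal of [M], nonzero by [Mh]. *)
exists G, (fun j => M (inord j.-1) (inord j)); split=> //.
  case=> // i /= lt_id; apply: (proj2 Mh); rewrite !inordK //; exact: ltnW.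
apply/matrixP => i j; rewrite -/M [RHS]mxE.
have [ij|ji|/val_inj->] := ltngtP i j; last by rewrite Mdiag.
  case: eqP => [e|ne]; first by rewrite e /= -{1}e !inord_val.
  by apply: (proj1 Mh); rewrite ltn_neqAle ij andbT eq_sym; apply/eqP.
by rewrite M0 // ltn_eqF // ltnW.
Qed.
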